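(* Let $g:\Sigma\to\mathbb{C}$ be a discrete holomorphic function with cross-ratios factorizing function $m$, let $H$ be a non-zero real constant, and let $h:\Sigma\to\mathbb{C}$ be a discrete holomorphic function defined by $$dh_{ij}=\frac{H}{m_{ij}\,dg_{ij}}=:H\omega_{ij}\quad\text{on every edge }(ij).$$ Then the discrete $1$-form $$dY_{ij}=\operatorname{Re}\big((\bar h_{ij}+g_{ij},\,1,\,-\mathrm{i})\,\omega_{ij}\big)\quad\text{on every edge }(ij)$$ defines (by recursion along edges, consistently, and uniquely up to translation) a discrete isothermic surface $Y:\Sigma\to\mathbb{I}^3$ of constant mean curvature $H$ with lightlike Gauss map $N:\Sigma\to\mathcal{L}\cap P$ given by $$N=-\tfrac12\big(1+|\varphi|^2,\;2\operatorname{Re}\varphi,\;-2\operatorname{Im}\varphi,\;-1+|\varphi|^2\big)^t,\qquad \varphi:=\bar h+g.$$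
   Context: Space: $\mathbb{R}^{3,1}$ is Minkowski $4$-space with bilinear form $(\cdot,\cdot)$ of signature $(-+++)$, $\mathcal{L}=\{X:(X,X)=0\}$, $\mathfrak{p}=(1,0,0,1)^t$, $\tilde{\mathfrak{p}}=\frac12(-1,0,0,1)^t$ (so $(\mathfrak{p},\tilde{\mathfrak{p}})=1$), $P=\{X:(X,\mathfrak{p})=1\}$. Isotropic $3$-space is $\mathbb{I}^3=\{X\in\mathbb{R}^{3,1}:(X,\mathfrak{p})=0\}=\mathbb{R}^2\oplus\langle\mathfrak{p}\rangle$ with $\mathbb{R}^2=\langle\mathfrak{p},\tilde{\mathfrak{p}}\rangle^\perp$; its points $(\mathbf l,\mathbf x,\mathbf y,\mathbf l)^t$ are also written $(\mathbf l,\mathbf x,\mathbf y)$. $\pi_2:\mathbb{R}^{3,1}\to\mathbb{R}^2$ is the orthogonal projection, so $\pi_2(\mathbf l,\mathbf x,\mathbf y)=(\mathbf x,\mathbf y)$, and $\mathbb{R}^2\cong\mathbb{C}$ via $\mathbf x+\mathrm{i}\mathbf y$. Domain: $\Sigma\subset\mathbb{Z}^2$ is a discrete simply-connected domain (connected through edges, and every closed edge path can be contracted through elementary quadrilaterals of $\Sigma$). Edges join horizontally or vertically adjacent points. An elementary quadrilateral $(ijk\ell)$ is $i=(a,b)$, $j=(a+1,b)$, $k=(a+1,b+1)$, $\ell=(a,b+1)$. For a function $f$ on $\Sigma$: $f_i=f(i)$, $df_{ij}=f_i-f_j$, $f_{ij}=\frac12(f_i+f_j)$; $\bar h_{ij}$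 is the edge mean of $\bar h$. Discrete holomorphic: $x:\Sigma\to\mathbb{C}$ is discrete holomorphic with cross-ratios factorizing function $m$ if $m$ is a real nowhere-vanishing function on unoriented edges such that on every elementary quadrilateral $m_{ij}=m_{\ell k}$, $m_{i\ell}=m_{jk}$ and $\frac{x_i-x_j}{x_j-x_k}\cdot\frac{x_k-x_\ell}{x_\ell-x_i}=\frac{m_{i\ell}}{m_{ij}}$ (in particular $x$ takes distinct values at the ends of each edge). Circular net: $X:\Sigma\to\mathbb{I}^3$ such that on each elementary quadrilateral the points $X_i,X_j,X_k,X_\ell$ are coplanar and their projections under $\pi_2$ are concircular in $\mathbb{R}^2$ (straight lines counting as degenerate circles). Discrete isothermic surface: a circular net $X$ for which $\pi_2(X):\Sigma\to\mathbb{C}$ is discrete holomorphic. Lightlike Gauss map of a circular net $X$: a map $N:\Sigma\to\mathcal{L}\cap P$ with $dN_{ij}$ parallel to (a real multiple of) $dX_{ij}$ on every edge, the multiple being non-zero generically. Mixed area of edge-parallel circular nets $X,\tilde X$: $A(X,\tilde X)_{ijk\ell}=\frac14\big((X_i-X_k)\wedge(\tilde X_j-\tilde X_\ell)-(X_j-X_\ell)\wedge(\tilde X_i-\tilde X_k)\big)\in\wedge^2\mathbb{R}^{3,1}$. The mean curvature $H_{ijk\ell}$ of a circular net $X$ with lightlike Gauss map $N$ is given by $A(X,N)_{ijk\ell}+H_{ijk\ell}A(X,X)_{ijk\ell}=0$; ''constant mean curvature $H$'' means this relation holds with $H_{ijk\ell}=H$ on every elementary quadrilateral. *)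

(* Defs.v *)
From mathcomp Require Import all_boot all_order all_algebra.
From mathcomp Require Import complex.
From mathcomp Require Import boolp classical_sets cardinality reals.

Set Implicit Arguments.
Unset Strict Implicit.
Unset Printing Implicit Defensive.

Import Order.TTheory GRing.Theory Num.Theory.

Local Open Scope classical_set_scope.
Local Open Scope ring_scope.
Local Open Scope complex_scope.

(* A domain is a subset S of Z^2.  Functions on S are total functions on
   Z^2 that are only ever evaluated at points of S. *)

Definition vertex : Type := (int * int)%type.

Definition east (p : vertex) : vertex := (p.1 + 1, p.2).
Definition north (p : vertex) : vertex := (p.1, p.2 + 1).

Definition adjacent (p q : vertex) : bool :=
  [|| q == east p, p == east q, q == north p | p == north q].

(* Oriented edges: every edge occurs in both directions. *)
Definition edge (S : set vertex) : rel vertex :=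
  fun p q => [&& p \in S, q \in S & adjacent p q].

Definition elementary_quad (S : set vertex) (i j k l : vertex) : Prop :=
  [/\ j = east i, k = north (east i), l = north i
    & [/\ i \in S, j \in S, k \in S & l \in S]].

(* Combinatorial homotopy of edge paths (lists of successive vertices),
   generated by removing a backtrack and contracting the boundary loop of an
   elementary quadrilateral.  Starting the loop at the corner i, with one
   orientation, is enough: the other corners and the reversed loop are
   obtained by combining it with backtracks. *)
Inductive homotopic (S : set vertex) : seq vertex -> seq vertex -> Prop :=
| homotopic_refl s : homotopic S s s
| homotopic_sym s t : homotopic S s t -> homotopic S t s
| homotopic_trans s t u :
    homotopic S s t -> homotopic S t u -> homotopic S s u
| homotopic_backtrack s t i j :
    edge S i j -> homotopic S (s ++ [:: i; j; i] ++ t) (s ++ [:: i] ++ t)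
| homotopic_quad s t i j k l :
    elementary_quad S i j k l ->
    homotopic S (s ++ [:: i; j; k; l; i] ++ t) (s ++ [:: i] ++ t).

Definition connected_domain (S : set vertex) : Prop :=
  forall i j, i \in S -> j \in S ->
    exists2 s, path (edge S) i s & last i s = j.

Definition simply_connected (S : set vertex) : Prop :=
  connected_domain S /\
  forall i s, i \in S -> path (edge S) i s -> last i s = i ->
    homotopic S (i :: s) [:: i].

Definition dd (V : zmodType) (f : vertex -> V) (i j : vertex) : V := f i - f j.

Section Complex.
Variable R : realType.
Implicit Types (S : set vertex) (x g h : vertex -> R[i]).
Implicit Types (m : vertex -> vertex -> R).

Definition edge_mean x (i j : vertex) : R[i] := (x i + x j) / 2.

Definition cross_ratio (a b c d : R[i]) : R[i] :=
  (a - b) / (b - c) * ((c - d) / (d - a)).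

Definition discrete_holomorphic_with S x m : Prop :=
  [/\ forall i j, edge S i j -> m i j = m j i,
      forall i j, edge S i j -> m i j != 0,
      forall i j, edge S i j -> x i != x j
    & forall i j k l, elementary_quad S i j k l ->
        [/\ m i j = m l k, m i l = m j k
          & cross_ratio (x i) (x j) (x k) (x l) = (m i l / m i j)%:C]].

Definition discrete_holomorphic S x : Prop :=
  exists m, discrete_holomorphic_with S x m.

Definition concircular (a b c d : R[i]) : Prop :=
  (exists (o : R[i]) (r : R), 0 < r /\
     forall z, z \in [:: a; b; c; d] -> `|z - o| = r%:C)
  \/
  (exists o u : R[i], u != 0 /\
     forall z, z \in [:: a; b; c; d] -> exists t : R, z = o + t%:C * u).

Definition omega g m (i j : vertex) : R[i] := ((m i j)%:C * dd g i j)^-1.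

End Complex.

Section Minkowski.
Variable R : realType.
Implicit Types (X Y : 'cV[R]_4) (S : set vertex) (F G : vertex -> 'cV[R]_4).

Definition vec4 (a b c d : R) : 'cV[R]_4 := \col_(i < 4) [:: a; b; c; d]`_i.

Definition mink X Y : R :=
  - (X 0 0 * Y 0 0) + X 1 0 * Y 1 0 + X 2 0 * Y 2 0 + X 3 0 * Y 3 0.

Definition frakp : 'cV[R]_4 := vec4 1 0 0 1.

Definition light_cone : set 'cV[R]_4 := [set X | mink X X = 0].
Definition planeP : set 'cV[R]_4 := [set X | mink X frakp = 1].
Definition isotropic_space : set 'cV[R]_4 := [set X | mink X frakp = 0].

(* The point of isotropic 3-space with coordinates (l, x, y). *)
Definition iso3 (l x y : R) : 'cV[R]_4 := vec4 l x y l.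

(* Orthogonal projection onto <p, p~>^perp, identified with C. *)
Definition pi2 X : R[i] := X 1 0 +i* X 2 0.

Definition coplanar (A B C D : 'cV[R]_4) : Prop :=
  exists O U V : 'cV[R]_4, forall X, X \in [:: A; B; C; D] ->
    exists s t : R, X = O + s *: U + t *: V.

Definition circular_net S F : Prop :=
  (forall i, i \in S -> isotropic_space (F i)) /\
  forall i j k l, elementary_quad S i j k l ->
    coplanar (F i) (F j) (F k) (F l) /\
    concircular (pi2 (F i)) (pi2 (F j)) (pi2 (F k)) (pi2 (F l)).

Definition discrete_isothermic S F : Prop :=
  circular_net S F /\ discrete_holomorphic S (pi2 \o F).

(* The multiple c may vanish on exceptional edges or for exceptional data;
   [gauss_map_regular] is the condition that it is non-zero on every edge. *)
Definition lightlike_gauss_map S F G : Prop :=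
  (forall i, i \in S -> (light_cone `&` planeP) (G i)) /\
  forall i j, edge S i j -> exists c : R, dd G i j = c *: dd F i j.

Definition gauss_map_regular S F G : Prop :=
  forall i j, edge S i j -> exists2 c : R, c != 0 & dd G i j = c *: dd F i j.

(* The exterior square is realized as the space of antisymmetric matrices. *)
Definition wedge X Y : 'M[R]_4 := X *m Y^T - Y *m X^T.

Definition mixed_area F G (i j k l : vertex) : 'M[R]_4 :=
  4^-1 *: (wedge (dd F i k) (dd G j l) - wedge (dd F j l) (dd G i k)).

Definition constant_mean_curvature S F G (H : R) : Prop :=
  forall i j k l, elementary_quad S i j k l ->
    mixed_area F G i j k l + H *: mixed_area F F i j k l = 0.

End Minkowski.

Section Weierstrass.
Variable R : realType.
Implicit Types (S : set vertex) (g h : vertex -> R[i]).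
Implicit Types (m : vertex -> vertex -> R).

Definition holomorphic_dual S g m (H : R) h : Prop :=
  forall i j, edge S i j -> dd h i j = H%:C * omega g m i j.

(* Re ((conj h_ij + g_ij, 1, - i) omega_ij) *)
Definition weierstrass_form g m h (i j : vertex) : 'cV[R]_4 :=
  let w := omega g m i j in
  iso3 (complex.Re ((edge_mean (fun q => (h q)^*%C) i j + edge_mean g i j) * w))
       (complex.Re (1 * w))
       (complex.Re (- 'i%C * w)).

Definition weierstrass_surface S g m h (Y : vertex -> 'cV[R]_4) : Prop :=
  (forall i, i \in S -> isotropic_space (Y i)) /\
  forall i j, edge S i j -> dd Y i j = weierstrass_form g m h i j.

Definition weierstrass_gauss_map g h (i : vertex) : 'cV[R]_4 :=
  let phi := (h i)^*%C + g i in
  let r2 := complex.Re (`|phi| ^+ 2) in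
  - 2^-1 *:
    vec4 (1 + r2) (2 * complex.Re phi) (- 2 * complex.Im phi) (- 1 + r2).

End Weierstrass.

(* Main.v *)
Require Import Defs.
From mathcomp Require Import all_boot all_order all_algebra.
From mathcomp Require Import complex.
From mathcomp Require Import boolp classical_sets cardinality reals.
From mathcomp Require Import ring lra.

(** The key is a normal form for the dual differential omega = 1 / (m dg) on
one quadrilateral.  Write a, b, c, d for the differences of g along its edges
ij, jk, kl, li, so that a + b + c + d = 0, and alpha = m_ij, beta = m_il.  The
cross-ratio condition says alpha a c = beta b d; with kappa the inverse of
this common value, omega takes the values kappa c, kappa d, kappa a, kappa b:
on every edge it is kappa times the difference of g along the opposite edge
([quad_opposite_dual]).  Hence omega is closed, and the division by dg has
disappeared from all further identities.  Moreover
kappa (g_i - g_k) (g_j - g_l) = kappa (a c - b d) = 1 / alpha - 1 / beta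
is real.

Write [re_form f w] for the vector Re ((f, 1, -i) w) of isotropic space, and
phi = conj h + g, with bars over pairs of vertices for means.  Then, for a net
Y integrating the Weierstrass form,
- Y_i - Y_k = re_form (conj h_ik + g_jl) (- kappa (g_i - g_k))
  ([re_form_diagonal]); applied to both halves of the quadrilateral this shows
  that the Weierstrass form is closed, and the surface exists because Sigma
  is simply connected ([potential]);
- N_p - N_q = re_form (conj h_pq + g_pq) (- conj (phi_p - phi_q)) for any two
  vertices ([gauss_map_difference]); on an edge
  conj (phi_p - phi_q) = (H + m |dg|^2) omega, so that dN is the multiple
  - (H + m |dg|^2) of dY ([gauss_map_edge]).  It can vanish only for H in the
  countable set of the values - m |dg|^2, which does not depend on h;
- W = N + H Y satisfies
  W_j - W_l = re_form (conj h_ik + g_jl) (- conj (g_j - g_l))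
  ([dual_net_diagonal]).

The first and the third formula involve the same coefficient, and
kappa (g_i - g_k) is a real multiple of conj (g_j - g_l), so Y_i - Y_k is a
real multiple of W_j - W_l, unless g_j = g_l and both Y_j - Y_l and W_j - W_l
vanish ([opposite_diagonals_parallel]).  Since
A(Y, N) + H A(Y, Y) = A(Y, W) is a combination of the wedge products of the
diagonals of Y with the opposite diagonals of W, this gives constant mean
curvature H.  It also gives planarity: W_j - W_l is a combination of the edges
jk and kl of Y, so Y_i - Y_k lies in the plane that these two edges span.

Finally, h and the projection of Y are nets with differential c omega, and the
normal form shows that they have the cross-ratios of g
([scaled_dual_holomorphic]); real cross-ratios give concircularity
([concircular_real_cross_ratio]). *)

Set Implicit Arguments.
Unset Strict Implicit.
Unset Printing Implicit Defensive.

Import Order.TTheory GRing.Theory Num.Theory.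

Local Open Scope classical_set_scope.
Local Open Scope ring_scope.
Local Open Scope complex_scope.

(** * Integration of closed forms on simply connected domains *)

Lemma quad_edges (S : set vertex) i j k l : elementary_quad S i j k l ->
  [/\ edge S i j, edge S j k, edge S k l & edge S l i].
Proof.
case=> -> -> -> [Si Sj Sk Sl]; rewrite /edge Si Sj Sk Sl /adjacent /=.
by rewrite !eqxx /= !orbT.
Qed.

Section Potential.
Variables (V : zmodType) (S : set vertex) (f : vertex -> vertex -> V).
Hypothesis simpS : simply_connected S.
Hypothesis f_anti : forall i j, edge S i j -> f j i = - f i j.
Hypothesis f_closed : forall i j k l, elementary_quad S i j k l ->
  f i j + f j k + f k l + f l i = 0.

(** Sums of [f] along arbitrary lists of vertices: the homotopy relation does
not restrict itself to edge paths. *)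
Fixpoint path_sum (i : vertex) (s : seq vertex) : V :=
  if s is j :: s' then f i j + path_sum j s' else 0.
Definition list_sum (s : seq vertex) : V :=
  if s is i :: s' then path_sum i s' else 0.

Lemma path_sum_cat i s t :
  path_sum i (s ++ t) = path_sum i s + path_sum (last i s) t.
Proof. by elim: s i => [|j s IHs] i /=; rewrite ?add0r // IHs addrA. Qed.

(** A loop of sum 0 can be inserted at any visit of its base point. *)
Lemma list_sum_loop s i u t : last i u = i -> path_sum i u = 0 ->
  list_sum (s ++ (i :: u) ++ t) = list_sum (s ++ [:: i] ++ t).
Proof.
move=> lastu u0; have eq_j j : path_sum j (s ++ (i :: u) ++ t) =
    path_sum j (s ++ [:: i] ++ t).
  by rewrite !path_sum_cat /= lastu u0.
case: s eq_j => [|k s] eq_j //=; first by rewrite path_sum_cat u0 lastu add0r.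
by have := eq_j k; rewrite /= => /addrI.
Qed.

Lemma homotopic_list_sum s t : homotopic S s t -> list_sum s = list_sum t.
Proof.
elim=> {s t} [//|s t _ -> //|s t u _ -> //|s t i j ij|s t i j k l ijkl].
- apply: (@list_sum_loop _ _ [:: j; i]) => //=.
  by rewrite addr0 (f_anti ij) subrr.
- apply: (@list_sum_loop _ _ [:: j; k; l; i]) => //=.
  by rewrite addr0 !addrA (f_closed ijkl).
Qed.

Lemma path_sum_closed i s :
  i \in S -> path (edge S) i s -> last i s = i -> path_sum i s = 0.
Proof.
by move=> Si Ps lasts; have /homotopic_list_sum := simpS.2 i s Si Ps lasts.
Qed.

(** The value at i is the sum along a chosen path from i to a base point o.
For an edge ij, the two loops o - i - o and o - i - j - o through the chosen
paths both have sum 0, and their difference is f i j. *)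
Lemma potential : exists F : vertex -> V,
  forall i j, edge S i j -> dd F i j = f i j.
Proof.
have [[o So]|S0] := pselect (exists o, o \in S); last first.
  by exists (fun=> 0) => i j /and3P[Si _ _]; case: S0; exists i.
have to_o i : exists s, i \in S -> path (edge S) i s /\ last i s = o.
  have [Si|_] := boolP (i \in S); last by exists [::].
  by have [s Ps lasts] := simpS.1 i o Si So; exists s.
have [p Pp] := choice to_o.
exists (fun i => path_sum i (p i)) => i j ij; have /and3P[Si Sj _] := ij.
have [[Pi lasti] [Pj lastj]] := (Pp i Si, Pp j Sj).
have [q Pq lastq] := simpS.1 o i So Si.
have /eqP : path_sum o (q ++ p i) = 0.
  by apply: path_sum_closed; rewrite ?cat_path ?last_cat ?lastq ?Pq.
have : path_sum o (q ++ j :: p j) = 0.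
  by apply: path_sum_closed; rewrite ?cat_path ?last_cat /= ?lastq ?Pq ?ij.
rewrite !path_sum_cat lastq addr_eq0 /= => eq_j /eqP eq_i.
apply/eqP; rewrite /dd subr_eq -(inj_eq (addrI (path_sum o q))).
by rewrite eq_j eq_i addNr.
Qed.
End Potential.

Lemma dd_unique (V : zmodType) (S : set vertex) (F G : vertex -> V) :
  connected_domain S ->
  (forall i j, edge S i j -> dd F i j = dd G i j) ->
  forall i j, i \in S -> j \in S -> F i - G i = F j - G j.
Proof.
move=> connS dFG i j Si Sj; have [s] := connS i j Si Sj.
elim: s i {Si} => [|k s IHs] i /=; first by move=> _ ->.
case/andP=> ik Ps lasts; rewrite -(IHs k Ps lasts).
have /eqP := dFG _ _ ik; rewrite /dd subr_eq => /eqP ->.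
by rewrite addrAC [G i - _ - _]addrAC subrr add0r addrC.
Qed.

(** * Concircularity and real cross-ratios *)

Section ComplexNumbers.
Variable R : realType.
Implicit Types z w : R[i].

Definition sqn z : R := complex.Re z ^+ 2 + complex.Im z ^+ 2.

Lemma mulJ z : z * conjc z = (sqn z)%:C.
Proof.
case: z => a b; apply/eqP; rewrite eq_complex /sqn /=; apply/andP.
by split; apply/eqP; ring.
Qed.

(** [conjc] and the notation for [Num.conj] print alike; these restatements keep
the rewritten terms in the form [conjc]. *)
Lemma conjc_half : conjc (2^-1 : R[i]) = 2^-1.
Proof. by rewrite fmorphV rmorph_nat. Qed.
Lemma conjcD z w : conjc (z + w) = conjc z + conjc w.
Proof. exact: rmorphD. Qed.
Lemma conjcN z : conjc (- z) = - conjc z.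
Proof. exact: rmorphN. Qed.
Lemma conjcM z w : conjc (z * w) = conjc z * conjc w.
Proof. exact: rmorphM. Qed.
Definition conjcE :=
  (conjc_half, conjcM, conjcD, conjcN, conjcK, @conjc_real R).

(** In the coordinate y with z = a + u y, a circle through a and a + u has an
equation |y|^2 - Re y = t Im y, and the line through them the equation
Im y = 0.  The hypothesis is the proportionality condition for w and v to lie
on a common curve of this pencil. *)
Lemma concircular_normal (a u w v : R[i]) : u != 0 ->
  complex.Im w * (sqn v - complex.Re v) =
    complex.Im v * (sqn w - complex.Re w) ->
  concircular a (a + u) (a + u * w) (a + u * v).
Proof.
move=> u0 eq_wv.
have mem_eq (P : R[i] -> Prop) : P 0 -> P 1 -> P w -> P v ->
    forall z, z \in [:: a; a + u; a + u * w; a + u * v] ->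
      exists2 y, z = a + u * y & P y.
  move=> P0 P1 Pw Pv z; rewrite !inE => /or4P[] /eqP ->.
  - by exists 0; rewrite // mulr0 addr0.
  - by exists 1; rewrite // mulr1.
  - by exists w.
  - by exists v.
suff [[t Pw Pv]|[w0 v0]] :
    (exists2 t, sqn w - complex.Re w = t * complex.Im w &
                sqn v - complex.Re v = t * complex.Im v) \/
    (complex.Im w = 0 /\ complex.Im v = 0).
(* The circle |y|^2 - Re y = t Im y has centre (1 + i t) / 2. *)
- left; pose c : R[i] := 2^-1 +i* (2^-1 * t).
  exists (a + u * c), (complex.Re `|u * c|).
  have c0 : 0 < `|u * c|.
    rewrite normr_gt0 mulf_neq0 // eq_complex /=.
    by rewrite negb_and invr_eq0 pnatr_eq0.
  split; first by move: c0; rewrite ltcE /= => /andP[].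
  pose P y := sqn y - complex.Re y = t * complex.Im y.
  move=> z /(mem_eq P)[]; rewrite /P //=.
  + by rewrite /sqn /=; ring.
  + by rewrite /sqn /=; ring.
  move=> y -> {z mem_eq eq_wv} Py.
  rewrite opprD addrACA subrr add0r -mulrBr normrM (_ : `|y - c| = `|c|).
    by rewrite -normrM.
  rewrite !normc_def; congr (Num.sqrt _)%:C.
  case: y Py => y1 y2; rewrite /sqn /= => Py.
  by lra.
- right; exists a, u; split=> //.
  move=> z /(mem_eq (fun y => complex.Im y = 0))[] //= y -> y0.
  by exists (complex.Re y); rewrite mulrC;
  case: y y0 => y1 y2 /= ->; rewrite complexr0.
have [w0|w0] := eqVneq (complex.Im w) 0; last first.
  left; exists ((sqn w - complex.Re w) / complex.Im w); first by rewrite divfK.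
  by apply: (mulfI w0); rewrite eq_wv; field.
have [v0|v0] := eqVneq (complex.Im v) 0; first by right.
left; exists ((sqn v - complex.Re v) / complex.Im v); last by rewrite divfK.
by apply: (mulfI v0); rewrite -eq_wv; field.
Qed.

(** In the coordinates of [concircular_normal] the cross-ratio is
(v - w) / (v (1 - w)); if it is real, so is (v - w) conj (v (1 - w)), and the
vanishing of its imaginary part is the condition of that lemma.  Opposite
vertices may coincide. *)
Lemma concircular_real_cross_ratio (a b c d : R[i]) (q : R) :
  a != b -> b != c -> d != a -> cross_ratio a b c d = q%:C ->
  concircular a b c d.
Proof.
move=> ab bc da eq_q.
have u0 : b - a != 0 by rewrite subr_eq0 eq_sym.
pose w := (c - a) / (b - a); pose v := (d - a) / (b - a).
have eq_w : c = a + (b - a) * w by rewrite /w mulrC divfK // addrC subrK.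
have eq_v : d = a + (b - a) * v by rewrite /v mulrC divfK // addrC subrK.
have w1 : 1 - w != 0.
  apply: contraNneq bc => /eqP; rewrite subr_eq0 => /eqP w1.
  by rewrite eq_w -w1 mulr1 addrC subrK.
have v0 : v != 0 by apply: contraNneq da => v0; rewrite eq_v v0 mulr0 addr0.
have eq_wv : v - w = q%:C * (v * (1 - w)).
  rewrite -eq_q /cross_ratio eq_w eq_v.
  have -> : a - b = - (b - a) by rewrite opprB.
  have -> : b - (a + (b - a) * w) = (b - a) * (1 - w) by ring.
  have -> : a + (b - a) * w - (a + (b - a) * v) = (b - a) * (w - v) by ring.
  have -> : a + (b - a) * v - a = (b - a) * v by ring.
  by field; rewrite u0 w1 v0.
rewrite eq_w eq_v -{1}[b](subrK a) [b - a + a]addrC.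
apply: concircular_normal => //.
move: eq_wv; case: (w) (v) => [wr wi] [vr vi] /eqP; rewrite eq_complex /sqn /=.
case/andP=> /eqP eq1 /eqP eq2.
have : (vi - wi) * (vr * (1 - wr) + vi * wi) =
       (vr - wr) * (vi * (1 - wr) - vr * wi) by rewrite eq1 eq2; ring.
by move=> real_cr; lra.
Qed.
End ComplexNumbers.

(** * Vectors of the Weierstrass form *)

Section ReForm.
Variable R : realType.
Implicit Types (g h x : vertex -> R[i]) (z w : R[i]).
Implicit Types (m : vertex -> vertex -> R).

(** Written as in [weierstrass_form], which unfolds to it. *)
Definition re_form (phi w : R[i]) : 'cV[R]_4 :=
  iso3 (complex.Re (phi * w)) (complex.Re (1 * w)) (complex.Re (- 'i%C * w)).

Lemma re_formE phi w :
  re_form phi w = iso3 (complex.Re (phi * w)) (complex.Re w) (complex.Im w).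
Proof. by congr iso3; case: w => a b /=; ring. Qed.

Lemma cV4P (X Y : 'cV[R]_4) :
  [/\ X 0 0 = Y 0 0, X 1 0 = Y 1 0, X 2 0 = Y 2 0 & X 3 0 = Y 3 0] -> X = Y.
Proof.
case=> h0 h1 h2 h3; apply/colP => -[[|[|[|[|//]]]] lt_i].
- by rewrite (_ : Ordinal lt_i = 0) //; apply: val_inj.
- by rewrite (_ : Ordinal lt_i = 1) //; apply: val_inj.
- by rewrite (_ : Ordinal lt_i = 2) //; apply: val_inj.
- by rewrite (_ : Ordinal lt_i = 3) //; apply: val_inj.
Qed.

Lemma re_form_coord phi w :
  [/\ re_form phi w 0 0 = complex.Re (phi * w),
      re_form phi w 1 0 = complex.Re w, re_form phi w 2 0 = complex.Im w
    & re_form phi w 3 0 = complex.Re (phi * w)].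
Proof. by rewrite re_formE !mxE. Qed.

Lemma ReD z w : complex.Re (z + w) = complex.Re z + complex.Re w.
Proof. by case: z; case: w. Qed.
Lemma Re_subJ z : complex.Re (z - conjc z) = 0.
Proof. by case: z => a b /=; ring. Qed.

(** Terms z - conj z are purely imaginary, so they do not affect the first
component. *)
Lemma re_form_add p q r u v d :
  p * u + q * v = r * (u + v) + (d - conjc d) ->
  re_form p u + re_form q v = re_form r (u + v).
Proof.
move=> eq_d; rewrite !re_formE; apply: cV4P; rewrite !mxE /=.
rewrite -ReD eq_d ReD Re_subJ addr0.
by case: u v {eq_d} => [u1 u2] [v1 v2].
Qed.

Lemma re_formZ t phi w : re_form phi (t%:C * w) = t *: re_form phi w.
Proof.
rewrite !re_formE; apply: cV4P; rewrite !mxE /=.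
by case: w phi => [a b] [c d] /=; split; ring.
Qed.
Lemma re_form0 phi : re_form phi 0 = 0.
Proof. by have := re_formZ 0 phi 0; rewrite mulr0 scale0r. Qed.
Lemma re_formN phi w : re_form phi (- w) = - re_form phi w.
Proof. by have := re_formZ (-1) phi w; rewrite rmorphN1 mulN1r scaleN1r. Qed.

Lemma edge_meanC x p q : edge_mean x p q = edge_mean x q p.
Proof. by rewrite /edge_mean addrC. Qed.

Lemma edge_meanE x p q :
  edge_mean x p q = (2^-1)%:C * (x p + x q).
Proof. by rewrite /edge_mean mulrC fmorphV rmorph_nat. Qed.

(** * Diagonals of a quadrilateral with its dual form *)

Local Notation conjf h := (fun q => conjc (h q)).

(** The mean of conj h on the edges can be replaced by its mean on the diagonal:
since dh is H times the form integrated here, the two resulting terms are, up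
to a real factor, x conj y and - conj (x conj y), whose sum is imaginary.  The
means of g satisfy an exact identity. *)
Lemma re_form_diagonal (H : R) (k : R[i]) g h p q r s :
  dd h p q = H%:C * (k * dd g r s) -> dd h q r = H%:C * (k * dd g s p) ->
  re_form (edge_mean (conjf h) p q + edge_mean g p q) (k * dd g r s) +
  re_form (edge_mean (conjf h) q r + edge_mean g q r) (k * dd g s p) =
  re_form (edge_mean (conjf h) p r + edge_mean g q s) (- (k * dd g p r)).
Proof.
move=> hpq hqr.
rewrite (_ : - _ = k * dd g r s + k * dd g s p); last by rewrite /dd; ring.
apply: (@re_form_add _ _ _ _ _
  (H%:C * (k * conjc k) * conjc (dd g s p) * dd g r s / 2)).
have eq_p : h p = h q + H%:C * (k * dd g r s) by rewrite -hpq /dd; ring.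
have eq_r : h r = h q - H%:C * (k * dd g s p) by rewrite -hqr /dd; ring.
rewrite /edge_mean eq_p eq_r /dd !conjcE.
by field.
Qed.

Lemma gauss_mapE g h p (phi := conjc (h p) + g p) :
  weierstrass_gauss_map g h p = - 2^-1 *:
    vec4 (1 + sqn phi) (2 * complex.Re phi) (- 2 * complex.Im phi)
      (- 1 + sqn phi).
Proof. by rewrite /weierstrass_gauss_map; cbv zeta; rewrite -!add_Re2_Im2. Qed.

(** The first component is |phi_p|^2 - |phi_q|^2 =
Re ((phi_p + phi_q) conj (phi_p - phi_q)), up to the factor - 1 / 2. *)
Lemma gauss_map_difference g h p q :
  dd (weierstrass_gauss_map g h) p q =
  re_form (edge_mean (conjf h) p q + edge_mean g p q)
    (- (dd h p q + conjc (dd g p q))).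
Proof.
rewrite /dd !gauss_mapE /sqn re_formE !edge_meanE.
case: (h p) (h q) (g p) (g q) => [h1 h2] [h3 h4] [g1 g2] [g3 g4].
by apply: cV4P; rewrite !mxE /=; split; field.
Qed.

(** The coefficient conj h_pr + g_qs is the one that [re_form_diagonal] gives
for the other diagonal pr.  The change of means is compensated because
(h_qs - h_pr) dg_qs = (g_pr - g_qs) dh_qs, both sides being
H k (g_qs - g_pr) dg_qs; what is left has the form z - conj z. *)
Lemma dual_net_diagonal (H : R) (k : R[i]) g h p q r s :
  dd h p q = H%:C * (k * dd g r s) -> dd h q r = H%:C * (k * dd g s p) ->
  dd h r s = H%:C * (k * dd g p q) ->
  dd (weierstrass_gauss_map g h) q s +
    H *: re_form (edge_mean (conjf h) q s + edge_mean g r p)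
           (- (k * dd g q s)) =
  re_form (edge_mean (conjf h) p r + edge_mean g q s) (- conjc (dd g q s)).
Proof.
move=> hpq hqr hrs.
have eq_p : h p = h q + H%:C * (k * dd g r s) by rewrite -hpq /dd; ring.
have eq_r : h r = h q - H%:C * (k * dd g s p) by rewrite -hqr /dd; ring.
have eq_s : h s = h q - H%:C * (k * dd g s q).
  have -> : h s = h r - dd h r s by rewrite /dd; ring.
  by rewrite hrs eq_r /dd; ring.
rewrite gauss_map_difference -re_formZ.
have -> : - conjc (dd g q s) =
    - (dd h q s + conjc (dd g q s)) + H%:C * - (k * dd g q s).
  by rewrite /dd eq_s /dd; ring.
apply: (@re_form_add _ _ _ _ _
  ((edge_mean g p r - edge_mean g q s) * dd h q s)).
rewrite /edge_mean /dd eq_p eq_r eq_s /dd !conjcE.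
by field.
Qed.

Lemma weierstrass_gauss_map_edge (H : R) g m h p q :
  m p q != 0 -> g p != g q -> dd h p q = H%:C * omega g m p q ->
  dd (weierstrass_gauss_map g h) p q =
  - (H + m p q * sqn (dd g p q)) *: weierstrass_form g m h p q.
Proof.
move=> m0; rewrite -subr_eq0 => dg0 hpq.
rewrite gauss_map_difference scaleNr -re_formZ -re_formN.
have mC0 : (m p q)%:C != 0 by rewrite (inj_eq (@complexI R) _ 0).
have -> : (H + m p q * sqn (dd g p q))%:C =
    H%:C + (m p q)%:C * (dd g p q * conjc (dd g p q)).
  by rewrite mulJ -rmorphM -rmorphD.
congr (re_form _ (- _)); rewrite hpq /omega.
by field; apply/andP.
Qed.

Lemma gauss_map_lightlike g h p :
  (@light_cone R `&` @planeP R) (weierstrass_gauss_map g h p).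
Proof.
rewrite gauss_mapE /sqn.
case: (h p) (g p) => [h1 h2] [g1 g2].
by split; rewrite /light_cone /planeP /= /mink !mxE /=; field.
Qed.

End ReForm.

(** * Mixed areas and planarity *)

Section Planarity.
Variable R : realType.
Implicit Types X Y : 'cV[R]_4.

Lemma wedgeDl X X' Y : wedge (X + X') Y = wedge X Y + wedge X' Y.
Proof. by rewrite /wedge linearD mulmxDl mulmxDr opprD addrACA. Qed.
Lemma wedgeZl t X Y : wedge (t *: X) Y = t *: wedge X Y.
Proof. by rewrite /wedge linearZ -scalemxAl -scalemxAr scalerBr. Qed.
Lemma wedgeC X Y : wedge X Y = - wedge Y X.
Proof. by rewrite /wedge opprB. Qed.
Lemma wedgeDr X Y Y' : wedge X (Y + Y') = wedge X Y + wedge X Y'.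
Proof. by rewrite wedgeC wedgeDl opprD -!wedgeC. Qed.
Lemma wedgeZr t X Y : wedge X (t *: Y) = t *: wedge X Y.
Proof. by rewrite wedgeC wedgeZl -scalerN -wedgeC. Qed.
Lemma wedgeX0 X : wedge X 0 = 0.
Proof. by rewrite -(scale0r 0) wedgeZr scale0r. Qed.
Lemma wedgeXX X : wedge X X = 0.
Proof. by rewrite /wedge subrr. Qed.

(** The left hand side is A(F, G + H F), as A is bilinear. *)
Lemma mixed_area_dual (F G : vertex -> 'cV[R]_4) (H : R) i j k l :
  wedge (dd F i k) (dd G j l + H *: dd F j l) = 0 ->
  wedge (dd F j l) (dd G i k + H *: dd F i k) = 0 ->
  mixed_area F G i j k l + H *: mixed_area F F i j k l = 0.
Proof.
move=> ik jl; rewrite /mixed_area scalerA mulrC -scalerA -scalerDr.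
rewrite scalerBr -!wedgeZr addrACA -opprD -!wedgeDr ik jl subrr.
by rewrite scaler0.
Qed.

Lemma coplanar_coincident (A B C D : 'cV[R]_4) : B = D -> coplanar A B C D.
Proof.
move=> ->; exists C, (A - C), (D - C) => X; rewrite !inE => /or4P[] /eqP ->.
- by exists 1, 0; rewrite scale1r scale0r addr0 addrC subrK.
- by exists 0, 1; rewrite scale1r scale0r addr0 addrC subrK.
- by exists 0, 0; rewrite !scale0r !addr0.
- by exists 0, 1; rewrite scale1r scale0r addr0 addrC subrK.
Qed.

Lemma coplanar_diagonal (A B C D : 'cV[R]_4) s t :
  A - C = s *: (B - C) + t *: (C - D) -> coplanar A B C D.
Proof.
move=> eqA; exists C, (B - C), (C - D) => X; rewrite !inE => /or4P[] /eqP ->.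
- by exists s, t; rewrite -addrA -eqA addrC subrK.
- by exists 1, 0; rewrite scale1r scale0r addr0 addrC subrK.
- by exists 0, 0; rewrite !scale0r !addr0.
- by exists 0, (-1); rewrite scale0r addr0 scaleN1r opprB addrC subrK.
Qed.

End Planarity.

(** * The Weierstrass representation *)

Section Weierstrass.
Variable R : realType.
Implicit Types (g h x : vertex -> R[i]) (z w : R[i]).
Implicit Types (m : vertex -> vertex -> R).

Local Notation conjf h := (fun q => conjc (h q)).

(** Stated cyclically, so that it is stable under rotation of the quadrilateral
and each fact about one diagonal yields the one about the other. *)
Definition opposite_dual g m (k : R[i]) p q r s : Prop :=
  [/\ omega g m p q = k * dd g r s, omega g m q r = k * dd g s p,
      omega g m r s = k * dd g p q & omega g m s p = k * dd g q r].

Lemma opposite_dual_rot g m k p q r s :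
  opposite_dual g m k p q r s -> opposite_dual g m k q r s p.
Proof. by case. Qed.

Section Net.
Variables (S : set vertex) (g : vertex -> R[i]) (m : vertex -> vertex -> R).
Hypothesis gm : discrete_holomorphic_with S g m.

Lemma dg_neq0 i j : edge S i j -> dd g i j != 0.
Proof. by case: gm => _ _ g_neq _ /g_neq; rewrite subr_eq0. Qed.

Lemma mC_neq0 i j : edge S i j -> (m i j)%:C != 0.
Proof.
by case: gm => _ m_neq _ _ /m_neq; rewrite (inj_eq (@complexI R) _ 0).
Qed.

Lemma omega_neq0 i j : edge S i j -> omega g m i j != 0.
Proof. by move=> ij; rewrite invr_neq0 // mulf_neq0 ?mC_neq0 ?dg_neq0. Qed.

Lemma omega_anti i j : edge S i j -> omega g m j i = - omega g m i j.
Proof.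
case: gm => m_sym _ _ _ /m_sym mij; rewrite /omega mij -invrN -mulrN.
by rewrite /dd opprB.
Qed.

Lemma weierstrass_form_anti h i j : edge S i j ->
  weierstrass_form g m h j i = - weierstrass_form g m h i j.
Proof.
move=> ij; rewrite /weierstrass_form omega_anti //.
rewrite -/(re_form _ _) -/(re_form _ (omega g m i j)) re_formN.
by rewrite edge_meanC [edge_mean g _ _]edge_meanC.
Qed.

(** [kappa] is 1 / (m_ij a c) = 1 / (m_il b d), and the real number [t] is
1 / m_ij - 1 / m_il. *)
Lemma quad_opposite_dual i j k l : elementary_quad S i j k l ->
  exists kappa, opposite_dual g m kappa i j k l /\
    exists t : R, kappa * (dd g i k * dd g j l) = t%:C.
Proof.
move=> quad; have [ij jk kl li] := quad_edges quad.
have [m_sym _ _ /(_ _ _ _ _ quad)[mij mil cr]] := gm.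
have [[a0 b0] [c0 d0]] := ((dg_neq0 ij, dg_neq0 jk), (dg_neq0 kl, dg_neq0 li)).
have mkl : m k l = m i j by rewrite mij m_sym.
have mli : m l i = m i l by rewrite m_sym.
have al0 := mC_neq0 ij; have be0 := mC_neq0 li; rewrite mli in be0.
have dg_ik : dd g i k = dd g i j + dd g j k by rewrite /dd; ring.
have dg_jl : dd g j l = dd g j k + dd g k l by rewrite /dd; ring.
have d_eq : dd g l i = - (dd g i j + dd g j k + dd g k l) by rewrite /dd; ring.
move: cr; rewrite /cross_ratio -!/(dd g _ _) fmorph_div.
rewrite /opposite_dual /omega mkl mli -mil.
set a := dd g i j in a0 dg_ik d_eq *.
set b := dd g j k in b0 dg_ik dg_jl d_eq *.
set c := dd g k l in c0 dg_jl d_eq *.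
set d := dd g l i in d0 d_eq *.
set al := (m i j)%:C in al0 *.
set be := (m i l)%:C in be0 *.
move=> cr; have be_eq : be = al * (a / b * (c / d)) by rewrite cr; field.
exists (al * a * c)^-1; split.
  rewrite be_eq; split; by field; rewrite ?a0 ?b0 ?c0 ?d0 ?al0.
exists ((m i j)^-1 - (m i l)^-1).
have -> : ((m i j)^-1 - (m i l)^-1)%:C = al^-1 - be^-1.
  by rewrite rmorphB !fmorphV.
have -> : dd g i k * dd g j l = a * c - b * d by rewrite dg_ik dg_jl d_eq; ring.
by rewrite be_eq; field; rewrite a0 b0 c0 d0 al0.
Qed.

(** The form omega is (c, d, a, b) up to a factor, and (c / d) (a / b) is the
cross-ratio of g. *)
Lemma scaled_dual_holomorphic x (c : R[i]) : c != 0 ->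
  (forall i j, edge S i j -> dd x i j = c * omega g m i j) ->
  discrete_holomorphic_with S x m.
Proof.
move=> c0 dx; case: (gm) => m_sym m_neq0 _ cr; split=> // [i j ij|i j k l quad].
  by rewrite -subr_eq0 -/(dd x i j) dx // mulf_neq0 ?omega_neq0.
have [mij mil <-] := cr _ _ _ _ quad; split=> //.
have [ij jk kl li] := quad_edges quad.
rewrite /cross_ratio -!/(dd x _ _) -!/(dd g _ _) !dx //.
have [kappa [kap _]] := quad_opposite_dual quad; have := omega_neq0 ij.
case: kap => -> -> -> ->; rewrite mulf_eq0 negb_or => /andP[k0 _].
have [[a0 b0] [c0' d0]] := ((dg_neq0 ij, dg_neq0 jk), (dg_neq0 kl, dg_neq0 li)).
by field; rewrite c0 k0 b0 d0.
Qed.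

Section Dual.
Variables (H : R) (h : vertex -> R[i]).
Hypothesis hH : holomorphic_dual S g m H h.

Let phi p q := edge_mean (conjf h) p q + edge_mean g p q.
Let N := weierstrass_gauss_map g h.

Lemma weierstrass_form_diagonal kappa p q r s : edge S p q -> edge S q r ->
  opposite_dual g m kappa p q r s ->
  weierstrass_form g m h p q + weierstrass_form g m h q r =
  re_form (edge_mean (conjf h) p r + edge_mean g q s) (- (kappa * dd g p r)).
Proof.
move=> pq qr [w1 w2 _ _].
by rewrite -(@re_form_diagonal _ H) ?hH // ?w1 ?w2 // -w1 -w2.
Qed.

(** The two halves of the quadrilateral, cut along the diagonal ik, contribute
opposite vectors. *)
Lemma weierstrass_closed i j k l : elementary_quad S i j k l ->
  weierstrass_form g m h i j + weierstrass_form g m h j k +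
  weierstrass_form g m h k l + weierstrass_form g m h l i = 0.
Proof.
move=> quad; have [ij jk kl li] := quad_edges quad.
have [kappa [dual _]] := quad_opposite_dual quad.
rewrite (weierstrass_form_diagonal ij jk dual) -addrA.
have dual' := opposite_dual_rot (opposite_dual_rot dual).
rewrite (weierstrass_form_diagonal kl li dual').
rewrite edge_meanC [edge_mean g l j]edge_meanC.
have -> : dd g k i = - dd g i k by rewrite /dd opprB.
by rewrite mulrN [X in _ + X]re_formN addrN.
Qed.

Variable Y : vertex -> 'cV[R]_4.
Hypothesis wY : weierstrass_surface S g m h Y.

Lemma gauss_map_edge i j : edge S i j ->
  dd N i j = - (H + m i j * sqn (dd g i j)) *: dd Y i j.
Proof.
move=> ij; have [_ m_neq0 g_neq _] := gm.
by rewrite wY.2 // (@weierstrass_gauss_map_edge _ H g m) ?m_neq0 ?g_neq ?hH.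
Qed.

Lemma surface_diagonal kappa p q r s : edge S p q -> edge S q r ->
  opposite_dual g m kappa p q r s ->
  dd Y p r =
  re_form (edge_mean (conjf h) p r + edge_mean g q s) (- (kappa * dd g p r)).
Proof.
move=> pq qr dual; rewrite -(weierstrass_form_diagonal pq qr dual) -!wY.2 //.
by rewrite /dd addrA subrK.
Qed.

(** Both diagonals are [re_form] with the same coefficient, applied to
- kappa dg_pr and - conj dg_qs, and kappa dg_pr = t conj dg_qs / |dg_qs|^2. *)
Lemma opposite_diagonals_parallel kappa (t : R) p q r s :
  edge S p q -> edge S q r -> edge S r s -> opposite_dual g m kappa p q r s ->
  kappa * (dd g p r * dd g q s) = t%:C ->
  (dd Y q s = 0 /\ dd N q s + H *: dd Y q s = 0) \/
  exists c, dd Y p r = c *: (dd N q s + H *: dd Y q s).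
Proof.
move=> pq qr rs dual kt; have [w1 w2 w3 _] := dual.
have dY_qs := surface_diagonal qr rs (opposite_dual_rot dual).
have dW : dd N q s + H *: dd Y q s =
    re_form (edge_mean (conjf h) p r + edge_mean g q s) (- conjc (dd g q s)).
  by rewrite dY_qs (@dual_net_diagonal _ H kappa) // hH // ?w1 ?w2 ?w3.
have [dg0|dg0] := eqVneq (dd g q s) 0.
  left; rewrite dW dg0 conjc0 oppr0 re_form0; split=> //.
  by rewrite dY_qs dg0 mulr0 oppr0 re_form0.
right; exists (t / sqn (dd g q s)); rewrite dW (surface_diagonal pq qr dual).
rewrite -re_formZ; congr re_form.
have -> : (t / sqn (dd g q s))%:C =
    kappa * (dd g p r * dd g q s) / (dd g q s * conjc (dd g q s)).
  by rewrite fmorph_div kt mulJ.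
by field; rewrite dg0 conjc_eq0 dg0.
Qed.

(** Unless Y_j = Y_l, the diagonal ik is a multiple of the diagonal jl of
N + H Y, whose edges are multiples of those of Y; hence it is a combination of
the edges jk and kl. *)
Lemma surface_coplanar i j k l : elementary_quad S i j k l ->
  coplanar (Y i) (Y j) (Y k) (Y l).
Proof.
move=> quad; have [ij jk kl li] := quad_edges quad.
have [kappa [dual [t kt]]] := quad_opposite_dual quad.
have [[/eqP + _]|[c]] := opposite_diagonals_parallel ij jk kl dual kt.
  by rewrite subr_eq0 => /eqP; apply: coplanar_coincident.
have dd3 (F : vertex -> 'cV[R]_4) : dd F j l = dd F j k + dd F k l.
  by rewrite /dd addrA subrK.
rewrite !dd3 !gauss_map_edge // (scalerDr H) addrACA -!scalerDl.
rewrite scalerDr !scalerA.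
exact: coplanar_diagonal.
Qed.

Lemma surface_cmc : constant_mean_curvature S Y N H.
Proof.
move=> i j k l quad; have [ij jk kl li] := quad_edges quad.
have [kappa [dual [t kt]]] := quad_opposite_dual quad.
have kt' : kappa * (dd g j l * dd g k i) = (- t)%:C.
  have -> : (- t)%:C = - t%:C by exact: rmorphN.
  by rewrite -kt /dd; ring.
apply: mixed_area_dual.
  have [[_ ->]|[c ->]] := opposite_diagonals_parallel ij jk kl dual kt.
    exact: wedgeX0.
  by rewrite wedgeZl wedgeXX scaler0.
have ki (F : vertex -> 'cV[R]_4) : dd F i k = - dd F k i by rewrite /dd opprB.
rewrite !ki scalerN -opprD -scaleN1r wedgeZr.
have [[_ ->]|[c ->]] :=
    opposite_diagonals_parallel jk kl li (opposite_dual_rot dual) kt'.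
  by rewrite wedgeX0 scaler0.
by rewrite wedgeZl wedgeXX !scaler0.
Qed.

Lemma surface_holomorphic : discrete_holomorphic_with S (pi2 (R:=R) \o Y) m.
Proof.
apply: (@scaled_dual_holomorphic _ 1); first exact: oner_neq0.
move=> i j ij; rewrite mul1r.
have dY : dd Y i j = re_form (phi i j) (omega g m i j) := wY.2 i j ij.
have [_ re im _] := re_form_coord (phi i j) (omega g m i j).
by apply/eqP; rewrite eq_complex -re -im -dY /dd !mxE /= !eqxx.
Qed.

Lemma surface_isothermic : discrete_isothermic S Y.
Proof.
have hol := surface_holomorphic.
split; last by exists m.
split=> [i Si|i j k l quad]; first exact: wY.1.
split; first exact: surface_coplanar.
have [ij jk kl li] := quad_edges quad.
have [_ _ x_neq /(_ _ _ _ _ quad)[_ _ cr]] := hol.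
by apply: concircular_real_cross_ratio cr; apply: x_neq.
Qed.

End Dual.
End Net.
End Weierstrass.

Theorem theorem3p8 (R : realType) (S : set vertex)
    (g : vertex -> R[i]) (m : vertex -> vertex -> R) :
  simply_connected S ->
  discrete_holomorphic_with S g m ->
  exists2 E : set R, countable E & forall H : R, H != 0 ->
    (exists h : vertex -> R[i], holomorphic_dual S g m H h) /\
    forall h : vertex -> R[i], holomorphic_dual S g m H h ->
      [/\ discrete_holomorphic S h,
          exists Y : vertex -> 'cV[R]_4, weierstrass_surface S g m h Y,
          forall Y Y' : vertex -> 'cV[R]_4,
            weierstrass_surface S g m h Y -> weierstrass_surface S g m h Y' ->
            exists2 v : 'cV[R]_4, isotropic_space v &
              forall i, i \in S -> Y' i = Y i + v
        & forall Y : vertex -> 'cV[R]_4, weierstrass_surface S g m h Y ->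
            [/\ discrete_isothermic S Y,
                lightlike_gauss_map S Y (weierstrass_gauss_map g h),
                ~ E H -> gauss_map_regular S Y (weierstrass_gauss_map g h)
              & constant_mean_curvature S Y (weierstrass_gauss_map g h) H]].
Proof.
move=> simpS gm; pose lambda p q := - (m p q * sqn (dd g p q)).
exists (range (fun e : vertex * vertex => lambda e.1 e.2)) => [|H H0].
  exact: card_le_trans (card_image_le _ _) (countableP _).
split.
  apply: potential => // [i j ij|i j k l quad].
    by rewrite (omega_anti gm ij) mulrN.
  have [kappa [[-> -> -> ->] _]] := quad_opposite_dual gm quad.
  by rewrite /dd; ring.
move=> h hH; split.
- exists m; apply: scaled_dual_holomorphic hH => //.
  by rewrite (inj_eq (@complexI R) _ 0).
- have [F dF] := potential simpS (weierstrass_form_anti gm h)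
    (weierstrass_closed gm hH).
  (* The form takes its values in isotropic space, so nothing is lost by
     replacing the last coordinate of the potential by the first one. *)
  exists (fun i => iso3 (F i 0 0) (F i 1 0) (F i 2 0)); split=> [i _|i j ij].
    by rewrite /isotropic_space /= /mink !mxE /=; ring.
  have -> : weierstrass_form g m h i j = iso3 (weierstrass_form g m h i j 0 0)
      (weierstrass_form g m h i j 1 0) (weierstrass_form g m h i j 2 0).
    by apply: cV4P; rewrite !mxE.
  by rewrite -dF //; apply: cV4P; rewrite /dd !mxE.
- move=> Y Y' [isoY dY] [isoY' dY'].
  have [[o So]|S0] := pselect (exists o, o \in S); last first.
    exists 0 => [|i Si]; last by case: S0; exists i.
    by rewrite /isotropic_space /= /mink !mxE /=; ring.
  exists (Y' o - Y o) => [|i Si].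
    move: (isoY o So) (isoY' o So).
    by rewrite /isotropic_space /= /mink !mxE /= => eqY eqY'; lra.
  have dYY' p q : edge S p q -> dd Y' p q = dd Y p q.
    by move=> pq; rewrite dY ?dY'.
  by rewrite -(dd_unique simpS.1 dYY' Si So) addrC subrK.
- move=> Y wY; have dN := gauss_map_edge gm hH wY.
  split; first exact: (surface_isothermic gm hH wY).
  + split=> [i _|i j /dN ->]; first exact: gauss_map_lightlike.
    by exists (- (H + m i j * sqn (dd g i j))).
  + move=> EH i j ij; exists (- (H + m i j * sqn (dd g i j))); last exact: dN.
    rewrite oppr_eq0; apply: contra_notN EH.
    by rewrite addr_eq0 => /eqP ->; exists (i, j).
  + exact: (surface_cmc gm hH wY).
Qed.
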